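(* There are absolute constants such that for all integers $n,d>1$ there exists an explicit homogeneous polynomial $f\in\mathbb{F}\langle x_1,\dots,x_n\rangle$ of degree $d$ such that every homogeneous non-commutative arithmetic circuit computing $f$ has non-scalar size $\Omega(nd)$ if $d\le n$, and $\Omega\!\left(nd\,\frac{\log n}{\log d}\right)$ if $d\ge n$.
   Context: Let $\mathbb{F}$ be an arbitrary fixed field. Non-commutative polynomials over $\mathbb{F}$ are elements of the free algebra $\mathbb{F}\langle x_1,\dots,x_n\rangle$. A polynomial is homogeneous if all its monomials with non-zero coefficient have the same degree. A non-commutative arithmetic circuit is a directed acyclic graph whose in-degree-zero nodes (input gates) are labelled by variables or field elements, and whose other nodes have in-degree two and are labelled $+$ or $\times$; the two edges into a $\times$ gate are labelled left and right, indicating the order of multiplication. Each gate computes a non-commutative polynomial; the circuit computes $f$ if some gate computes $f$. The circuit is homogeneous if every gate computes a homogeneous polynomial. A product gate is non-scalar if both of its inputs compute non-constant polynomials; the non-scalar size is the number of non-scalar product gates. *)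

(* Defs.v *)
From HB Require Import structures.
From mathcomp Require Import all_boot all_order all_algebra.
From mathcomp Require Import finmap.
From mathcomp.multinomials Require Import monalg.

Set Implicit Arguments.
Unset Strict Implicit.
Unset Printing Implicit Defensive.

Import GRing.Theory.
Local Open Scope ring_scope.

(* The free algebra F<x_0, ..., x_(n-1)>, as the algebra of the free monoid. *)
Notation ncpoly F n := {malg F[{fmonom 'I_n}]}.

Section NCPoly.
Variables (F : fieldType) (n : nat).
Implicit Type p : ncpoly F n.

Definition ncvar (i : 'I_n) : ncpoly F n := << fmu i >>.

Definition is_constant p : bool := p == (p@_mone)%:MP.

Definition homogeneous p : Prop :=
  {in msupp p &, forall m1 m2, fdeg m1 = fdeg m2}.

Definition homogeneous_of_degree (d : nat) p : Prop :=
  p != 0 /\ {in msupp p, forall m, fdeg m = d}.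

End NCPoly.

Section Circuits.
Variables (F : fieldType) (n : nat).

Inductive gate_label (V : Type) : Type :=
  | InVar of 'I_n
  | InConst of F
  | Plus of V & V
  | Times of V & V.  (* left factor, right factor *)

Definition inputs (V : Type) (l : gate_label V) : seq V :=
  match l with
  | InVar _ | InConst _ => [::]
  | Plus u v | Times u v => [:: u; v]
  end.

Definition wire (V : eqType) (lab : V -> gate_label V) : rel V :=
  fun u v => u \in inputs (lab v).

Record circuit : Type := Circuit {
  gate :> finType;
  label : gate -> gate_label gate;
  circuit_acyclic : forall s : seq gate, cycle (wire label) s -> s = [::]
}.

Definition label_value (V : Type) (val : V -> ncpoly F n) (l : gate_label V) :
    ncpoly F n :=
  match l with
  | InVar i => ncvar F i
  | InConst a => a%:MP
  | Plus u v => val u + val v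
  | Times u v => val u * val v
  end.

Variable C : circuit.

Fixpoint unfold_gate (k : nat) (g : C) : ncpoly F n :=
  if k is k'.+1 then label_value (unfold_gate k') (label g) else 0.

(* Directed paths of C have at most #|C| gates, so #|C| levels of unfolding
   reach the input gates: see gate_polyE. *)
Definition gate_poly (g : C) : ncpoly F n := unfold_gate #|C| g.

Lemma unfold_gate_path k g : unfold_gate k g != unfold_gate k.+1 g ->
  exists2 s, size s = k & path (fun u v => wire (@label C) v u) g s.
Proof.
elim: k g => [|k IHk] g; first by exists [::].
have step u : u \in inputs (label g) -> unfold_gate k u != unfold_gate k.+1 u ->
    exists2 s, size s = k.+1 & path (fun u v => wire (@label C) v u) g s.
  by move=> ug /IHk[s <- ps]; exists (u :: s) => //=; rewrite ps andbT.
rewrite -[X in X != _]/(label_value (unfold_gate k) (label g)).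
rewrite -[X in _ != X]/(label_value (unfold_gate k.+1) (label g)).
move: step; case: (label g) => [i|a|u v|u v] step; rewrite ?eqxx //= => neq.
  have [eu|] := eqVneq (unfold_gate k u) (unfold_gate k.+1 u); last first.
    by apply: step; rewrite !inE eqxx.
  have [ev|] := eqVneq (unfold_gate k v) (unfold_gate k.+1 v); last first.
    by apply: step; rewrite !inE eqxx orbT.
  by move: neq; rewrite {1}eu {1}ev eqxx.
have [eu|] := eqVneq (unfold_gate k u) (unfold_gate k.+1 u); last first.
  by apply: step; rewrite !inE eqxx.
have [ev|] := eqVneq (unfold_gate k v) (unfold_gate k.+1 v); last first.
  by apply: step; rewrite !inE eqxx orbT.
by move: neq; rewrite {1}eu {1}ev eqxx.
Qed.

Lemma wire_path_uniq g s :
  path (fun u v => wire (@label C) v u) g s -> uniq (g :: s).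
Proof.
elim: s g => [//|h s IHs] g; rewrite cons_uniq [path _ _ _]/= => /andP[hg phs].
rewrite IHs // andbT.
apply/negP => gs; case/splitPl: gs phs => s1 s2 eg.
rewrite cat_path => /andP[p1 _].
suff: rev (h :: s1) = [::] by move/(congr1 size); rewrite size_rev.
by apply: (@circuit_acyclic C); rewrite rev_cycle /= rcons_path p1 eg.
Qed.

Lemma gate_polyE g : gate_poly g = label_value gate_poly (label g).
Proof.
have eqU : unfold_gate #|C| g = unfold_gate #|C|.+1 g.
  apply: contraTeq isT => /unfold_gate_path[s sz /wire_path_uniq/card_uniqP c].
  by have := max_card (mem (g :: s)); rewrite c /= sz ltnn.
by rewrite /gate_poly {1}eqU.
Qed.

Definition homogeneous_circuit : Prop := forall g : C, homogeneous (gate_poly g).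

Definition computes (f : ncpoly F n) : Prop := exists g : C, gate_poly g = f.

Definition nonscalar (g : C) : bool :=
  if label g is Times u v then
    ~~ is_constant (gate_poly u) && ~~ is_constant (gate_poly v)
  else false.

Definition nonscalar_size : nat := #|[set g : C | nonscalar g]|.

End Circuits.

(* Explicitness means that the coefficients are computable in polynomial time.
   The model is the unit-cost random access machine of Cook and Reckhow, with
   addition and truncated subtraction (and no multiplication, so that it is
   polynomially equivalent to Turing machines), as structured programs. *)
Inductive ram_prog : Type :=
  | RSkip
  | RConst of nat & nat          (* r_x := c *)
  | RAdd of nat & nat & nat      (* r_x := r_y + r_z *)
  | RSub of nat & nat & nat      (* r_x := r_y - r_z *)
  | RLoad of nat & nat           (* r_x := mem[r_y] *)
  | RStore of nat & nat          (* mem[r_x] := r_y *)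
  | RSeq of ram_prog & ram_prog
  | RIf of nat & ram_prog & ram_prog   (* if r_x != 0 *)
  | RWhile of nat & ram_prog.          (* while r_x != 0 *)

Record ram_state : Type :=
  RamState { ram_reg : nat -> nat; ram_mem : nat -> nat }.

Definition set_reg (s : ram_state) (x v : nat) : ram_state :=
  RamState [eta ram_reg s with x |-> v] (ram_mem s).

Definition set_mem (s : ram_state) (a v : nat) : ram_state :=
  RamState (ram_reg s) [eta ram_mem s with a |-> v].

(* ram_exec P s t s' : started in s, P halts in s' after t steps. *)
Inductive ram_exec : ram_prog -> ram_state -> nat -> ram_state -> Prop :=
  | exec_skip s : ram_exec RSkip s 1%N s
  | exec_const s x c : ram_exec (RConst x c) s 1%N (set_reg s x c)
  | exec_add s x y z :
      ram_exec (RAdd x y z) s 1%N (set_reg s x (ram_reg s y + ram_reg s z)%N)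
  | exec_sub s x y z :
      ram_exec (RSub x y z) s 1%N (set_reg s x (ram_reg s y - ram_reg s z)%N)
  | exec_load s x y :
      ram_exec (RLoad x y) s 1%N (set_reg s x (ram_mem s (ram_reg s y)))
  | exec_store s x y :
      ram_exec (RStore x y) s 1%N (set_mem s (ram_reg s x) (ram_reg s y))
  | exec_seq P Q s1 s2 s3 t1 t2 :
      ram_exec P s1 t1 s2 -> ram_exec Q s2 t2 s3 ->
      ram_exec (RSeq P Q) s1 (t1 + t2)%N s3
  | exec_if_true x P Q s1 s2 t : ram_reg s1 x != 0%N ->
      ram_exec P s1 t s2 -> ram_exec (RIf x P Q) s1 t.+1 s2
  | exec_if_false x P Q s1 s2 t : ram_reg s1 x = 0%N ->
      ram_exec Q s1 t s2 -> ram_exec (RIf x P Q) s1 t.+1 s2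
  | exec_while_true x P s1 s2 s3 t1 t2 : ram_reg s1 x != 0%N ->
      ram_exec P s1 t1 s2 -> ram_exec (RWhile x P) s2 t2 s3 ->
      ram_exec (RWhile x P) s1 (t1 + t2).+1 s3
  | exec_while_false x P s : ram_reg s x = 0%N -> ram_exec (RWhile x P) s 1%N s.

(* Registers 0, 1, 2 hold n, d and the length of the word w; the memory holds
   the letters of w (each an index below n). *)
Definition ram_input (n d : nat) (w : seq 'I_n) : ram_state :=
  RamState (nth 0%N [:: n; d; size w]) (nth 0%N (map val w)).

(* One program computes all the coefficients of all the f n d, in time
   polynomial in n, d and the degree of the monomial; the coefficient is the
   image in F of the natural number left in register 0. As the base of the
   power is at least 4, an exponent k captures every polynomial bound. *)
Definition explicit (F : fieldType) (f : forall n d : nat, ncpoly F n) : Prop :=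
  exists (P : ram_prog) (k : nat),
  forall n d : nat, (1 < n)%N -> (1 < d)%N -> forall w : {fmonom 'I_n},
  exists (t : nat) (s : ram_state),
    [/\ ram_exec P (ram_input d w) t s,
        (t <= (n + d + fdeg w) ^ k)%N
      & (f n d)@_w = (ram_reg s 0%N)%:R].

(* Main.v *)
Require Import Defs.
From HB Require Import structures.
From mathcomp Require Import all_boot all_order all_algebra.
From mathcomp Require Import finmap.
From mathcomp.multinomials Require Import monalg.
From mathcomp Require Import reals exp.
From mathcomp Require Import zify ring lra.

Set Implicit Arguments.
Unset Strict Implicit.
Unset Printing Implicit Defensive.

Import Order.TTheory GRing.Theory Num.Theory.
Local Open Scope ring_scope.

(** For a homogeneous polynomial [g], consider the coefficients of the words
    x_0^i y x_0^j, with [y] ranging over words of length [l + 1], as vectors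
    indexed by [y], one for each [i]. In a product [u * v] of homogeneous
    polynomials, a window [y] lies inside one factor, and then the vector comes
    from that factor up to a scalar, or it straddles the cut, whose position is
    fixed by the degree of [u]; hence each product adds at most [l] new vectors,
    and sums add none.

    To gain a factor [n], write f = sum_i x_i f_i. As in the Baur-Strassen
    theorem, all the [f_i] can be computed together at the price of one more
    product per product of the circuit, so the windows of all the [f_i] span a
    space of dimension at most [2 * l * s]. The words x_i x_0^j x_i (j in base n)
    make this dimension about [n * d] with [l] about log d / log n. Moreover the
    [f_i] lie in the span of [s] polynomials, which settles small degrees. *)

(** * Word coefficients and homogeneous polynomials *)

Section WordCoefficients.
Variables (F : fieldType) (n : nat).
Implicit Types (g u v : ncpoly F n) (w : seq 'I_n).

Definition wcoef g w : F := g@_(FMonom w).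

Lemma wcoefP g1 g2 : (forall w, wcoef g1 w = wcoef g2 w) -> g1 = g2.
Proof. by move=> eq_g; apply/malgP => -[w]; apply: eq_g. Qed.

Lemma wcoef0 w : wcoef 0 w = 0.
Proof. exact: mcoeff0. Qed.

Lemma wcoefD g1 g2 w : wcoef (g1 + g2) w = wcoef g1 w + wcoef g2 w.
Proof. exact: mcoeffD. Qed.

Lemma wcoefZ c g w : wcoef (c *: g) w = c * wcoef g w.
Proof. exact: mcoeffZ. Qed.

Lemma wcoef_sum (I : Type) (r : seq I) (P : pred I) (G : I -> ncpoly F n) w :
  wcoef (\sum_(i <- r | P i) G i) w = \sum_(i <- r | P i) wcoef (G i) w.
Proof. exact: (big_morph (wcoef^~ w) (fun _ _ => wcoefD _ _ _) (wcoef0 w)). Qed.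

Lemma wcoefC c w : wcoef c%:MP w = if w is [::] then c else 0.
Proof. by rewrite /wcoef mcoeffC fmP fm1; case: w. Qed.

Lemma wcoef_var i w : wcoef (ncvar F i) w = (w == [:: i])%:R.
Proof. by rewrite /wcoef /ncvar mcoeffU1 eq_sym fmP fmU. Qed.

Lemma ncpoly_scaleAr c u v : c *: (u * v) = u * (c *: v).
Proof.
apply/malgP => m; rewrite mcoeffZ mcoeffMl.
rewrite (mcoeffMlw m (fsubset_refl (msupp u)) (msuppZ_le c v)) mulr_sumr.
apply: eq_bigr => k1 _; rewrite mulr_sumr; apply: eq_bigr => k2 _.
by rewrite mcoeffZ mulrnAr mulrCA.
Qed.

Definition homog (a : nat) g := forall w, size w != a -> wcoef g w = 0.

(** Every monomial of [u] has length [a], so at most one way of cutting [w] contributes. If [w] is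
    shorter than [a], both sides vanish. *)
Lemma wcoefM a u v w : homog a u ->
  wcoef (u * v) w = wcoef u (take a w) * wcoef v (drop a w).
Proof.
move=> hu; rewrite /wcoef mcoeffMl.
have szu (m : {fmonom 'I_n}) : m \in msupp u -> size m = a.
  case: m => m mu; apply/eqP; apply: contraLR mu => /hu.
  by rewrite /wcoef => /eqP; rewrite mcoeff_eq0.
have -> : u@_(FMonom (take a w)) * v@_(FMonom (drop a w)) =
    \sum_(k1 <- msupp u) \sum_(k2 <- msupp v)
      (u@_k1 * v@_k2) *+ ((k1 == FMonom (take a w)) && (k2 == FMonom (drop a w))).
  transitivity (\sum_(k1 <- msupp u) u@_k1 *+ (k1 == FMonom (take a w)) *
      \sum_(k2 <- msupp v) v@_k2 *+ (k2 == FMonom (drop a w))).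
    have pick (g : ncpoly F n) m :
        \sum_(k <- msupp g) g@_k *+ (k == m) = g@_m.
      case: (msuppP g m) => [mg|mg].
        rewrite (big_rem m) //= eqxx big_seq big1 ?addr0 // => k.
        rewrite rem_filter ?fset_uniq // mem_filter /= => /andP[/negbTE-> _].
        by [].
      rewrite big_seq big1 // => k kg; case: eqP => // ekm.
      by rewrite -ekm kg in mg.
    by rewrite -big_distrl /= !pick.
  apply: eq_bigr => k1 _; rewrite big_distrr /=; apply: eq_bigr => k2 _.
  by case: (k1 == _); case: (k2 == _); rewrite ?mulr0n ?mulr0 ?mul0r.
apply: eq_big_seq => k1 k1u; apply: eq_bigr => k2 _; congr (_ *+ _).
congr nat_of_bool; rewrite !fmP fmM /=.
have {k1u} := szu _ k1u; case: k1 k2 => [s1] [s2] /= sz1.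
have [szw|szw] := leqP a (size w).
  by rewrite -{1}(cat_take_drop a w) eqseq_cat // sz1 size_takel.
have -> : (s1 == take a w) = false.
  by apply/negP => /eqP e; move: szw; rewrite -sz1 e size_take_min; lia.
by apply/negP => /eqP e; move: szw; rewrite -e size_cat sz1; lia.
Qed.

Lemma homogM a b u v : homog a u -> homog b v -> homog (a + b) (u * v).
Proof.
move=> hu hv w szw; rewrite (wcoefM _ _ hu).
have [szwa|szwa] := eqVneq (size (take a w)) a; last by rewrite hu ?mul0r.
rewrite hv ?mulr0 // size_drop; apply: contra szw; move: szwa.
by rewrite size_take_min; lia.
Qed.

Lemma homog0 a : homog a 0.
Proof. by move=> w _; rewrite wcoef0. Qed.

Lemma homogZ a c g : homog a g -> homog a (c *: g).
Proof. by move=> hg w szw; rewrite wcoefZ hg ?mulr0. Qed.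

Lemma homog_sum a (I : finType) (P : pred I) (G : I -> ncpoly F n) :
  (forall i, P i -> homog a (G i)) -> homog a (\sum_(i | P i) G i).
Proof. by move=> hG w szw; rewrite wcoef_sum big1 // => i /hG ->. Qed.

Lemma homogeneous_homog g : homogeneous g -> exists a, homog a g.
Proof.
move=> hg; have [->|] := eqVneq g 0; first by exists 0%N; apply: homog0.
rewrite -msupp_eq0 => /fset0Pn[m mg]; exists (fdeg m) => w szw.
apply/eqP; rewrite mcoeff_eq0; apply: contra szw => wg.
by rewrite -(hg _ _ wg mg).
Qed.

Lemma homog0_const g : homog 0 g -> is_constant g.
Proof.
move=> hg; apply/eqP; apply: wcoefP => -[|x w]; last by rewrite wcoefC hg.
by rewrite wcoefC /wcoef -fmoneE.
Qed.

Lemma nonconstant_homog g : homogeneous g -> ~~ is_constant g ->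
  exists2 a, (0 < a)%N & homog a g.
Proof.
move=> /homogeneous_homog[[|a] ha]; last by exists a.+1.
by rewrite homog0_const.
Qed.

Lemma homogeneous_of_degreeP d g w :
  (forall w', size w' != d -> wcoef g w' = 0) -> wcoef g w != 0 ->
  homogeneous_of_degree d g.
Proof.
move=> hg gw; split; first by apply: contraNneq gw => ->; rewrite wcoef0.
move=> [m] mg; apply/eqP; apply: contraLR mg => /hg e.
by rewrite -mcoeff_eq0; apply/eqP.
Qed.

End WordCoefficients.

(** * Windows of homogeneous polynomials and of their products *)

Section Windows.
Variables (F : fieldType) (n : nat) (x0 : 'I_n) (l : nat).
Variables (T : finType) (y : T -> seq 'I_n).
Hypothesis size_y : forall t, size (y t) = l.+1.
Implicit Types (g u v : ncpoly F n) (X : seq 'rV[F]_#|T|).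

Definition window i j g : 'rV[F]_#|T| :=
  \row_t wcoef g (nseq i x0 ++ y (enum_val t) ++ nseq j x0).

Definition windows_in X g := forall i j, window i j g \in <<X>>%VS.

Lemma windowD i j g1 g2 : window i j (g1 + g2) = window i j g1 + window i j g2.
Proof. by apply/rowP => t; rewrite !mxE wcoefD. Qed.

Lemma windowZ i j c g : window i j (c *: g) = c *: window i j g.
Proof. by apply/rowP => t; rewrite !mxE wcoefZ. Qed.

Lemma window0 i j : window i j 0 = 0.
Proof. by apply/rowP => t; rewrite !mxE wcoef0. Qed.

Lemma windows_in0 X : windows_in X 0.
Proof. by move=> i j; rewrite window0 mem0v. Qed.

Lemma windows_inZ X c g : windows_in X g -> windows_in X (c *: g).
Proof. by move=> Xg i j; rewrite windowZ memvZ. Qed.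

Lemma windows_in_sum X (I : finType) (P : pred I) (G : I -> ncpoly F n) :
  (forall i, P i -> windows_in X (G i)) -> windows_in X (\sum_(i | P i) G i).
Proof.
move=> XG; apply: big_ind => [|g1 g2 Xg1 Xg2 i j|//]; first exact: windows_in0.
by rewrite windowD memvD.
Qed.

Lemma windows_inS X1 X2 g :
  {subset X1 <= X2} -> windows_in X1 g -> windows_in X2 g.
Proof. by move=> /sub_span/subvP sX Xg i j; apply/sX/Xg. Qed.

Lemma windows_in_short X a g : homog a g -> (a <= l)%N -> windows_in X g.
Proof.
move=> hg le_al i j; rewrite (_ : window i j g = 0) ?mem0v //.
apply/rowP => t; rewrite !mxE hg // !size_cat !size_nseq size_y; lia.
Qed.

(* Homogeneity determines the rest of the window's position from [p], the number
   of its letters that fall in the left factor. *)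
Definition crossing a b u v (p : nat) : 'rV[F]_#|T| :=
  \row_t (wcoef u (nseq (a - p) x0 ++ take p (y (enum_val t))) *
          wcoef v (drop p (y (enum_val t)) ++ nseq (b - (l.+1 - p)) x0)).

Definition crossings a b u v := [seq crossing a b u v p | p <- iota 1 l].

Lemma size_crossings a b u v : size (crossings a b u v) = l.
Proof. by rewrite size_map size_iota. Qed.

Lemma windows_inM X a b u v : homog a u -> homog b v ->
  {subset crossings a b u v <= X} ->
  windows_in X u -> windows_in X v -> windows_in X (u * v).
Proof.
move=> hu hv sX Xu Xv i j.
have [szw|szw] := eqVneq (i + l.+1 + j)%N (a + b)%N; last first.
  rewrite (_ : window i j _ = 0) ?mem0v //; apply/rowP => t.
  by rewrite !mxE (homogM hu hv) // !size_cat !size_nseq size_y addnA.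
(* The window lies in [u], and [v] contributes only its coefficient at x_0^b. *)
have [le_a|lt_a] := leqP (i + l.+1) a.
  rewrite (_ : window i j _ =
    wcoef v (nseq b x0) *: window i (a - (i + l.+1)) u) ?memvZ //.
  apply/rowP => t; rewrite !mxE (wcoefM _ _ hu) mulrC.
  rewrite !take_cat !drop_cat !size_nseq size_y.
  do 2![rewrite ifF; last by lia].
  rewrite ifF; last by lia. rewrite ifF; last by lia.
  rewrite take_nseq ?drop_nseq; last by lia.
  by congr (wcoef v (nseq _ _) * wcoef u (_ ++ _ ++ nseq _ _)); lia.
have [le_i|lt_i] := leqP a i.
  rewrite (_ : window i j _ =
    wcoef u (nseq a x0) *: window (i - a) j v) ?memvZ //.
  apply/rowP => t; rewrite !mxE (wcoefM _ _ hu).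
  rewrite take_cat drop_cat size_nseq.
  case: ltngtP le_i => // [lt_ai|<-] _; last by rewrite subnn take0 drop0 cats0.
  by rewrite take_nseq ?drop_nseq 1?ltnW.
(* The cut falls inside the window, after its first [a - i] letters, a number between 1 and [l]. *)
rewrite (_ : window i j _ = crossing a b u v (a - i)).
  by apply/memv_span/sX/map_f; rewrite mem_iota; lia.
apply/rowP => t; rewrite !mxE (wcoefM _ _ hu).
rewrite !take_cat !drop_cat !size_nseq size_y.
rewrite ifF; last by lia. rewrite ifT; last by lia.
rewrite ifF; last by lia. rewrite ifT; last by lia.
by congr (wcoef u (nseq _ _ ++ _) * wcoef v (_ ++ nseq _ _)); lia.
Qed.

End Windows.

(** * Families of products whose factors lie in their own span *)

Section ProductFamilies.
Variables (F : fieldType) (n : nat) (H : finType).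
Variables (U V : H -> ncpoly F n) (a b : H -> nat).
Hypothesis a_gt0 : forall h, (0 < a h)%N.
Hypothesis b_gt0 : forall h, (0 < b h)%N.
Hypothesis homogU : forall h, homog (a h) (U h).
Hypothesis homogV : forall h, homog (b h) (V h).
Arguments homogU : clear implicits.
Arguments homogV : clear implicits.
Implicit Types (g : ncpoly F n).

(** What the products give without further non-scalar multiplication: constants, linear forms and
    linear combinations of products. *)
Definition in_span g := exists (c0 : F) (e : 'I_n -> F) (c : H -> F),
  forall w, wcoef g w = c0 * (nilp w)%:R + \sum_i e i * (w == [:: i])%:R +
    \sum_h c h * wcoef (U h * V h) w.

Lemma in_span_coef k g : in_span g -> (0 < k)%N ->
  exists (e : 'I_n -> F) (c : H -> F), forall w, size w = k ->
    wcoef g w = \sum_i e i * (w == [:: i])%:R +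
      \sum_(h | (a h + b h)%N == k) c h * wcoef (U h * V h) w.
Proof.
move=> [c0 [e [c Eg]]] k_gt0; exists e, c => w szw; rewrite Eg.
have -> : nilp w = false by rewrite /nilp szw; case: k k_gt0 {szw}.
rewrite mulr0 add0r; congr (_ + _).
rewrite [RHS]big_mkcond /=; apply: eq_bigr => h _.
case: eqP => // /eqP ne; rewrite (homogM (homogU h) (homogV h)) ?mulr0 //.
by rewrite szw eq_sym.
Qed.

(** Comparing coefficients in degree [k] discards the products of other degrees; [1 < k] also
    removes the constants and linear forms. *)
Lemma in_span_homog k g : homog k g -> in_span g -> (1 < k)%N ->
  exists c : H -> F, g = \sum_(h | (a h + b h)%N == k) c h *: (U h * V h).
Proof.
move=> hg sg k_gt1; have [|e [c Ec]] := @in_span_coef k g sg; first by lia.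
exists c; apply: wcoefP => w; rewrite wcoef_sum.
under eq_bigr => h _ do rewrite wcoefZ.
have [szw|szw] := eqVneq (size w) k.
  rewrite Ec // big1 ?add0r // => i _; case: eqP => [ew|]; last by rewrite mulr0.
  by rewrite -szw ew in k_gt1.
rewrite hg // big1 // => h /eqP sz.
by rewrite (homogM (homogU h) (homogV h)) ?mulr0 ?sz.
Qed.

Hypothesis spanU : forall h, in_span (U h).
Hypothesis spanV : forall h, in_span (V h).

Section Windows.
Variables (x0 : 'I_n) (l : nat) (T : finType) (y : T -> seq 'I_n).
Hypothesis size_y : forall t, size (y t) = l.+1.
Hypothesis l_gt0 : (0 < l)%N.

Local Notation crossings := (@crossings F n x0 l T y).
Local Notation windows_in := (@windows_in F n x0 T y).

Definition product_crossings : seq 'rV[F]_#|T| :=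
  flatten [seq crossings (a h) (b h) (U h) (V h) | h <- enum H].

Lemma size_flatten_crossings (D : seq H) (A B : H -> nat) P Q :
  size (flatten [seq crossings (A h) (B h) (P h) (Q h) | h <- D]) =
  (l * size D)%N.
Proof.
elim: D => [|h D IH] /=; first by rewrite muln0.
by rewrite size_cat IH size_crossings mulnS.
Qed.

Lemma windows_in_span k g : homog k g -> in_span g ->
  (forall h, (a h + b h)%N = k -> windows_in product_crossings (U h * V h)) ->
  windows_in product_crossings g.
Proof.
move=> hg sg Xk; have [k_gt1|k_le1] := ltnP 1 k; last first.
  by apply: (windows_in_short _ size_y _ hg); lia.
have [c ->] := in_span_homog hg sg k_gt1.
by apply: windows_in_sum => h /eqP /Xk; apply: windows_inZ.
Qed.

(** Strong induction on the degree of the product: its factors have smaller degree, so they expand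
    into products already treated, or are too short to have a window. Only the crossings of the
    product itself are new. *)
Lemma windows_in_products h : windows_in product_crossings (U h * V h).
Proof.
have [k] := ubnP (a h + b h); elim: k h => // k IHk h lt_k.
have Xlt g j : (j < k)%N -> homog j g -> in_span g ->
    windows_in product_crossings g.
  by move=> lt_jk hg sg; apply: (windows_in_span hg sg) => h' ?; apply: IHk; lia.
have [ah bh] := (a_gt0 h, b_gt0 h).
apply: (windows_inM size_y (homogU h) (homogV h)); first last.
- by apply: Xlt (homogV h) (spanV h); lia.
- by apply: Xlt (homogU h) (spanU h); lia.
by move=> z zc; apply/flatten_mapP; exists h; rewrite ?mem_enum.
Qed.

Variables (d : nat) (f : ncpoly F n).
Hypothesis d_gt1 : (1 < d)%N.
Hypothesis homogf : homog d f.
Hypothesis spanf : in_span f.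

(* The products [h] with [a h <= k < a h + b h] are those whose left factor ends
   at or before position [k] and whose right factor contains it, when they are
   placed at the left end of [f]. Lowering [k] replaces the left factors of
   degree [k] by products, as in the Baur-Strassen argument. *)
Lemma cut_decomposition k : (0 < k < d)%N ->
  exists (X : seq 'rV[F]_#|T|) (Q : H -> ncpoly F n),
  [/\ (size X <= l * (#|H| + #|[pred h | (k < a h + b h)%N]|))%N,
      f = \sum_(h | (a h <= k < a h + b h)%N) U h * Q h &
      forall h, (a h <= k < a h + b h)%N ->
        homog (d - a h) (Q h) /\ windows_in X (Q h)] /\
  {subset product_crossings <= X}.
Proof.
have XV h : windows_in product_crossings (V h).
  apply: (windows_in_span (homogV h) (spanV h)) => h' _.
  exact: windows_in_products.
move=> /andP[]; move eq_r: (d.-1 - k)%N => r.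
elim: r k eq_r => [|r IHr] k eq_r k_gt0 k_ltd.
  have [c Ef] := in_span_homog homogf spanf d_gt1.
  (* At [k = d - 1] the expansion of [f] into products of degree [d] has the required form; the
     other cofactors are set to 0. *)
  exists product_crossings, (fun h => if (a h + b h)%N == d then c h *: V h else 0).
  split=> //; split.
  - rewrite size_flatten_crossings -cardE leq_mul2l leq_addr orbT //.
  - rewrite Ef [LHS]big_mkcond [RHS]big_mkcond /=; apply: eq_bigr => h _.
    have := b_gt0 h; case: (eqVneq (a h + b h)%N d) => [e bh|_ _].
      by rewrite ifT; [rewrite ncpoly_scaleAr | lia].
    by rewrite mulr0 if_same.
  - move=> h _; case: eqP => [e|_]; last first.
      by split; [apply: homog0 | apply: windows_in0].
    split; last exact: windows_inZ.
    by apply: homogZ; rewrite -e addKn; apply: homogV.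
have [||| X [Q [[sX Ef XQ] sPX]]] := IHr k.+1; [lia..|].
have /fin_all_exists[be Ebe] h : exists c : H -> F, a h = k.+1 ->
    U h = \sum_(h' | (a h' + b h')%N == k.+1) c h' *: (U h' * V h').
  case: (eqVneq (a h) k.+1) => [eh|/eqP //]; last by exists (fun=> 0).
  have hU := homogU h; rewrite eh in hU.
  by have [//|c ?] := in_span_homog hU (spanU h); exists c.
pose D := [pred h | (a h + b h == k.+1)%N].
(* After substituting the expansions [be] of the left factors of degree [k + 1] and exchanging sums,
   [R h] collects all that multiplies [U h * V h], so [V h * R h] becomes the cofactor of [U h]. *)
pose R h := \sum_(h' | a h' == k.+1) be h' h *: Q h'.
have hR h : homog (d - k.+1) (R h).
  apply: homog_sum => h' /eqP eh'; apply: homogZ; rewrite -eh'.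
  by case: (XQ h') => //; have := b_gt0 h'; lia.
have XR h : windows_in X (R h).
  apply: windows_in_sum => h' /eqP eh'; apply: windows_inZ.
  by case: (XQ h') => //; have := b_gt0 h'; lia.
(* Only products of degree [k + 1] need new crossings, so over the whole descent each product is
   charged at most once. *)
exists (X ++ flatten [seq crossings (b h) (d - k.+1) (V h) (R h) | h <- enum D]).
exists (fun h => if D h then V h * R h else Q h).
split; last by move=> z /sPX zX; rewrite mem_cat zX.
split.
- rewrite size_cat size_flatten_crossings -cardE.
  apply: leq_trans (leq_add sX (leqnn _)) _; rewrite -mulnDr leq_mul2l.
  rewrite -addnA leq_add2l -cardUI.
  rewrite (eq_card (B := [pred h | (k < a h + b h)%N])); last first.
    by move=> h; rewrite !inE /=; lia.
  rewrite [X in (_ + X)%N]eq_card0 ?addn0 ?leqnn ?orbT //.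
  by move=> h; rewrite !inE /=; apply/negbTE; lia.
- rewrite [RHS](bigID D) /= [X in _ = X + _](_ : _ =
      \sum_(h | a h == k.+1) U h * Q h); last first.
    transitivity (\sum_(h | a h == k.+1)
        \sum_(h' | D h') be h h' *: (U h' * V h' * Q h)).
      rewrite exchange_big /=; apply: eq_big => [h|h /andP[_ ->]].
        by rewrite /D /=; have := b_gt0 h; lia.
      rewrite mulrA /R mulr_sumr; apply: eq_bigr => h' _.
      by rewrite ncpoly_scaleAr.
    apply: eq_bigr => h /eqP eh; rewrite (Ebe h eh) mulr_suml.
    by apply: eq_bigr => h' _; apply: scalerAl.
  rewrite [LHS]Ef [LHS](bigID (fun h => a h == k.+1)) /=; apply: congr2.
    by apply: eq_bigl => h; have := b_gt0 h; lia.
  apply: eq_big => [h|h hh]; first by rewrite /D /=; lia.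
  by rewrite /D /= ifF //; lia.
- move=> h hk; rewrite /D /=; case: (eqVneq (a h + b h)%N k.+1) => [eh|neh].
    split.
      have -> : (d - a h = b h + (d - k.+1))%N by lia.
      by apply: homogM.
    apply: (windows_inM size_y (homogV h) (hR h)).
    + move=> z zc; rewrite mem_cat; apply/orP; right.
      by apply/flatten_mapP; exists h => //; rewrite mem_enum inE /= eh.
    + by apply: windows_inS (XV h) => z /sPX zX; rewrite mem_cat zX.
    + by apply: windows_inS (XR h) => z zX; rewrite mem_cat zX.
  have [|hQ XQh] := XQ h; first by lia.
  by split=> //; apply: windows_inS XQh => z zX; rewrite mem_cat zX.
Qed.

(** At the cut [k = 1] all left factors are linear forms, so removing the first letter of [f] leaves
    combinations of the cofactors [Q h], which are the same for every letter. *)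
Lemma first_letter_decomposition :
  exists (X : seq 'rV[F]_#|T|) (Q : H -> ncpoly F n) (e : H -> 'I_n -> F),
  [/\ (size X <= l * (2 * #|H|))%N,
      forall h, windows_in X (Q h) &
      forall i w, wcoef f (i :: w) = \sum_h e h i * wcoef (Q h) w].
Proof.
have [X [Q [[sX Ef XQ] _]]] : _ := @cut_decomposition 1 d_gt1.
pose P h := (a h <= 1 < a h + b h)%N.
exists X, (fun h => if P h then Q h else 0).
exists (fun h i => if P h then wcoef (U h) [:: i] else 0); split.
- apply: leq_trans sX _; rewrite leq_mul2l mul2n -addnn leq_add2l max_card.
  by rewrite orbT.
- move=> h; case: ifP => [/XQ[]//|_]; exact: windows_in0.
- move=> i w; rewrite Ef wcoef_sum big_mkcond; apply: eq_bigr => h _ /=.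
  rewrite /P; case: ifP => [hP|]; last by rewrite mul0r.
  have a1 : a h = 1%N by have := a_gt0 h; lia.
  by rewrite (wcoefM _ _ (homogU h)) a1 /= take0 drop0.
Qed.

End Windows.
End ProductFamilies.

(** * A dimension count, and closure properties of [in_span] *)

Lemma leq_card_span (F : fieldType) m (X : seq 'rV[F]_m) :
  (forall t, delta_mx 0 t \in <<X>>%VS) -> (m <= size X)%N.
Proof.
move=> Xd; apply: leq_trans (dim_span X).
suff /dimvS : (fullv <= <<X>>)%VS by rewrite dimvf /dim /= mul1n.
apply/subvP => v _.
by rewrite (row_sum_delta v); apply: memv_suml => t _; apply: memvZ.
Qed.

Section SpanClosure.
Variables (F : fieldType) (n : nat) (H : finType) (U V : H -> ncpoly F n).
Implicit Types g : ncpoly F n.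

Lemma in_spanC c : in_span U V c%:MP.
Proof.
exists c, (fun=> 0), (fun=> 0) => w; rewrite wcoefC !big1 => [|i _|i _].
- by case: w => [|x w]; rewrite !addr0 ?mulr1 ?mulr0.
- by rewrite mul0r.
- by rewrite mul0r.
Qed.

Lemma in_span_var i : in_span U V (ncvar F i).
Proof.
exists 0, (fun j => (j == i)%:R), (fun=> 0) => w.
rewrite wcoef_var mul0r add0r (bigD1 i) //= eqxx mul1r !big1 ?addr0 //.
  by move=> h _; rewrite mul0r.
by move=> j /negbTE->; rewrite mul0r.
Qed.

Lemma in_span_product h : in_span U V (U h * V h).
Proof.
exists 0, (fun=> 0), (fun j => (j == h)%:R) => w.
rewrite [X in _ = _ + X](bigD1 h) //= eqxx mul1r mul0r !big1 ?addr0 ?add0r //.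
  by move=> j /negbTE->; rewrite mul0r.
by move=> i _; rewrite mul0r.
Qed.

Lemma in_spanD g1 g2 : in_span U V g1 -> in_span U V g2 -> in_span U V (g1 + g2).
Proof.
move=> [c1 [e1 [k1 E1]]] [c2 [e2 [k2 E2]]].
exists (c1 + c2), (fun i => e1 i + e2 i), (fun h => k1 h + k2 h) => w.
rewrite wcoefD E1 E2 mulrDl.
under [X in _ = _ + X + _]eq_bigr do rewrite mulrDl.
under [X in _ = _ + X]eq_bigr do rewrite mulrDl.
by rewrite !big_split /=; ring.
Qed.

Lemma in_spanZ c g : in_span U V g -> in_span U V (c *: g).
Proof.
move=> [c0 [e [k E]]].
exists (c * c0), (fun i => c * e i), (fun h => c * k h) => w.
rewrite wcoefZ E; under [X in _ = _ + X + _]eq_bigr do rewrite -mulrA.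
under [X in _ = _ + X]eq_bigr do rewrite -mulrA.
by rewrite -!mulr_sumr -mulrA -!mulrDr.
Qed.

End SpanClosure.

(** * The non-scalar products of a circuit *)

Section CircuitProducts.
Variables (F : fieldType) (n : nat) (C : circuit F n).

(** A rank that strictly increases along wires because the circuit is acyclic; it drives the
    induction over gates. *)
Definition gates_below (g : C) := #|[pred h | connect (wire (@label _ _ C)) h g]|.

Lemma wire_gates_below u g :
  wire (@label _ _ C) u g -> (gates_below u < gates_below g)%N.
Proof.
move=> ug; apply/proper_card/properP; split.
  apply/subsetP => h; rewrite !inE => hu.
  exact: connect_trans hu (connect1 ug).
exists g; rewrite !inE ?connect0 //; apply/negP => /connectP[s sp elast].
suff: g :: s = [::] by [].
by apply: (@circuit_acyclic _ _ C); rewrite /= rcons_path sp -elast.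
Qed.

Definition left_factor (g : C) : ncpoly F n :=
  if label g is Times u _ then gate_poly u else 0.
Definition right_factor (g : C) : ncpoly F n :=
  if label g is Times _ v then gate_poly v else 0.

Local Notation H := {g : C | nonscalar g}.

(** Sums are linear and a scalar product multiplies by a field element, so only non-scalar gates
    bring new generators. *)
Lemma gate_in_span (g : C) :
  in_span (fun h : H => left_factor (val h)) (fun h => right_factor (val h))
    (gate_poly g).
Proof.
have [k] := ubnP (gates_below g); elim: k g => // k IHk g lt_gk.
have {IHk} IH (u : C) : u \in inputs (label g) -> in_span
    (fun h : H => left_factor (val h)) (fun h => right_factor (val h))
    (gate_poly u).
  by move=> ug; apply: IHk; apply: leq_trans (wire_gates_below ug) _.
have := gate_polyE g.
case lab_g: (label g) IH => [i|c|u v|u v] IH /= ->.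
- exact: in_span_var.
- exact: in_spanC.
- by apply: in_spanD; apply: IH; rewrite !inE eqxx ?orbT.
have IHu := IH u (mem_head u [:: v]).
have IHv := IH v (mem_last u [:: v]).
have [gns|] := boolP (nonscalar g).
  have := in_span_product (fun h : H => left_factor (val h))
    (fun h => right_factor (val h)) (Sub g gns).
  by rewrite /left_factor /right_factor SubK lab_g.
move=> scalar_g.
have : is_constant (gate_poly u) || is_constant (gate_poly v).
  move: scalar_g; rewrite /nonscalar lab_g.
  by case: (is_constant _) => //=; case: (is_constant _).
move: (gate_poly u) (gate_poly v) IHu IHv => gu gv sgu sgv.
case/orP=> /eqP->; first by rewrite mul_malgC; apply: in_spanZ.
rewrite -[_%:MP]mulr1 mul_malgC -ncpoly_scaleAr mulr1.
exact: in_spanZ.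
Qed.

Lemma circuit_decomposition (x0 : 'I_n) (l d : nat) (T : finType)
    (y : T -> seq 'I_n) (f : ncpoly F n) :
  homogeneous_circuit C -> computes C f -> homog d f -> (1 < d)%N ->
  (0 < l)%N -> (forall t, size (y t) = l.+1) ->
  exists (X : seq 'rV[F]_#|T|) (Q : H -> ncpoly F n) (e : H -> 'I_n -> F),
  [/\ (size X <= l * (2 * nonscalar_size C))%N,
      forall h, windows_in x0 y X (Q h) &
      forall i w, wcoef f (i :: w) = \sum_h e h i * wcoef (Q h) w].
Proof.
move=> homC [g <-] hf d_gt1 l_gt0 size_y.
(* A factor of a non-scalar gate is homogeneous and not constant, hence of positive degree, as the
   inductions on degree require. *)
have nonconst (P : C -> ncpoly F n) :
    (forall h, nonscalar h -> homogeneous (P h) /\ ~~ is_constant (P h)) ->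
    exists a : H -> nat,
      (forall h, 0 < a h)%N /\ forall h, homog (a h) (P (val h)).
  move=> hP; have /fin_all_exists[a aP] (h : H) :
      exists a, (0 < a)%N /\ homog a (P (val h)).
    have [hom nc] := hP _ (valP h).
    by have [a a_gt0 ha] := nonconstant_homog hom nc; exists a.
  by exists a; split=> h; case: (aP h).
have [|a [a_gt0 ha]] := nonconst left_factor.
  move=> h; rewrite /nonscalar /left_factor; case: (label h) => // u v.
  by case/andP=> nu _; split; first exact: homC.
have [|b [b_gt0 hb]] := nonconst right_factor.
  move=> h; rewrite /nonscalar /right_factor; case: (label h) => // u v.
  by case/andP=> _ nv; split; first exact: homC.
have -> : nonscalar_size C = #|{: H}| by rewrite card_sig -cardsE.
apply: (first_letter_decomposition a_gt0 b_gt0 ha hb) hf _ => // [h|h|].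
- rewrite /left_factor; case: (label _) => [i|c|u v|u v];
    by [apply: gate_in_span | rewrite -malgC0E; apply: in_spanC].
- rewrite /right_factor; case: (label _) => [i|c|u v|u v];
    by [apply: gate_in_span | rewrite -malgC0E; apply: in_spanC].
- exact: gate_in_span.
Qed.
End CircuitProducts.

(** * The hard polynomial *)

Section HardWords.
Variable n : nat.
Local Open Scope nat_scope.

(* Value in base [n], least significant digit first; trailing zeros, that is
   letters x_0, do not change it. *)
Fixpoint base_val (s : seq nat) : nat :=
  if s is a :: s' then base_val s' * n + a else 0.

(** The counter [p] is the number of letters x_0 already read; at the first nonzero letter it equals
    the exponent to be spelled by the rest. *)
Fixpoint coded (i p : nat) (s : seq nat) : bool :=
  if s is a :: s' then
    if a == 0 then coded i p.+1 s' else (a == i) && (base_val s' == p)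
  else false.

(* The words x_i x_0^j x_i s of length [d], where i > 0 and [s] spells [j] in
   base [n]. *)
Definition hard_word (d : nat) (s : seq nat) : bool :=
  (size s == d) && (if s is i :: s' then coded i 0 s' else false).

Lemma base_val_nseq0 k : base_val (nseq k 0) = 0.
Proof. by elim: k => //= k ->. Qed.

Lemma coded_nseq0 i p k s : coded i p (nseq k 0 ++ s) = coded i (p + k) s.
Proof. by elim: k p => [|k IHk] p /=; rewrite ?addn0 // IHk addSnnS. Qed.

End HardWords.

Section HardPolynomial.
Variable F : fieldType.

Definition hard_poly (n d : nat) : ncpoly F n :=
  \sum_(t : d.-tuple 'I_n) << (hard_word n d (map val t))%:R *g FMonom t >>.

Lemma wcoef_hard_poly n d (w : seq 'I_n) :
  wcoef (hard_poly n d) w = (hard_word n d (map val w))%:R.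
Proof.
rewrite wcoef_sum.
have coefU (t : d.-tuple 'I_n) :
    wcoef << (hard_word n d (map val t))%:R *g FMonom t >> w =
    (hard_word n d (map val w))%:R *+ (w == t) :> F.
  rewrite /wcoef mcoeffU fmP /= eq_sym.
  by case: eqP => // ->.
under eq_bigr => t _ do rewrite coefU.
have [szw|szw] := eqVneq (size w) d.
  rewrite (bigD1 (tcast szw (in_tuple w))) //= val_tcast eqxx big1 ?addr0 //.
  move=> t; rewrite -val_eqE /= val_tcast eq_sym => /negbTE -> //.
rewrite /hard_word size_map (negbTE szw) big1 // => t _.
by rewrite mul0rn.
Qed.

Lemma homog_hard_poly n d : homog d (hard_poly n d).
Proof.
by move=> w szw; rewrite wcoef_hard_poly /hard_word size_map (negbTE szw).
Qed.

Lemma hard_poly_homogeneous n d : (1 < n)%N -> (1 < d)%N ->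
  homogeneous_of_degree d (hard_poly n d).
Proof.
case: n => [|[|m]] // _ d_gt1; pose x1 : 'I_m.+2 := inord 1.
(* The word x_1 x_1 x_0^(d-2) encodes [j = 0]. *)
apply: (homogeneous_of_degreeP (w := x1 :: x1 :: nseq (d - 2) ord0)).
  exact: homog_hard_poly.
rewrite wcoef_hard_poly /hard_word /= size_map size_nseq map_nseq inordK //=.
by rewrite base_val_nseq0 !eqxx andbT -addn2 subnK // eqxx oner_eq0.
Qed.

End HardPolynomial.

(** * Lower bound for the hard polynomial *)

Section LowerBound.
Variables (F : fieldType) (m d : nat) (C : circuit F m.+2).
Hypothesis d_gt1 : (1 < d)%N.
Hypothesis homC : homogeneous_circuit C.
Hypothesis compC : computes C (hard_poly F m.+2 d).

Local Notation n := m.+2.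

Fixpoint digits (l j : nat) : seq 'I_n :=
  if l is l'.+1 then inord (j %% n) :: digits l' (j %/ n) else [::].

Lemma size_digits l j : size (digits l j) = l.
Proof. by elim: l j => //= l IHl j; rewrite IHl. Qed.

Lemma base_val_digits l j k : (j < n ^ l)%N ->
  base_val n (map val (digits l j) ++ nseq k 0%N) = j.
Proof.
elim: l j => [|l IHl] j /=; first by rewrite base_val_nseq0; case: j.
move=> lt_j; rewrite IHl; last by rewrite ltn_divLR // mulnC -expnS.
by rewrite inordK ?ltn_mod // -divn_eq.
Qed.

Let letter (i : 'I_m.+1) : 'I_n := lift ord0 i.

Lemma wcoef_hard_letters (i i' : 'I_m.+1) j k s : (j + k + size s).+2 = d ->
  wcoef (hard_poly F n d) (letter i :: nseq j ord0 ++ letter i' :: s ++ nseq k ord0)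
  = ((i == i') && (base_val n (map val s ++ nseq k 0%N) == j))%:R.
Proof.
move=> szd; rewrite wcoef_hard_poly /hard_word size_map /= !size_cat /=.
rewrite size_cat !size_nseq.
have -> : ((j + (size s + k).+1).+1 == d)%N by apply/eqP; lia.
rewrite !map_cat /= map_cat !map_nseq coded_nseq0 /= add0n.
by rewrite /bump !leq0n !add1n eqSS [i == i']eq_sym.
Qed.

(** Let [y] spell a nonzero letter followed by [l] digits. The window of f_i preceded by x_0^j is
    then the unit vector at (i, j), as [n ^ l] is large enough for [l] digits to determine [j]. All
    these unit vectors lie in the span of [X]. *)
Lemma lower_bounds l : (0 < l)%N -> (d.-1 - l <= n ^ l)%N ->
  (m.+1 <= nonscalar_size C)%N /\
  (m.+1 * (d.-1 - l) <= l * (2 * nonscalar_size C))%N.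
Proof.
move=> l_gt0 le_nl; pose T : finType := ('I_m.+1 * 'I_(d.-1 - l))%type.
pose y (t : T) := letter t.1 :: digits l t.2.
have size_y t : size (y t) = l.+1 by rewrite /= size_digits.
have [X [Q [e [sX XQ Ef]]]] := circuit_decomposition (ord0 : 'I_n) homC compC
  (@homog_hard_poly F n d) d_gt1 l_gt0 size_y.
split.
  (* For the first bound, the coefficients of the f_i at the words x_t x_0^(d-2), the case [j = 0],
     form an identity matrix. *)
  pose Y := [seq \row_t wcoef (Q h) (letter t :: nseq (d - 2) ord0)
            | h : {g : C | nonscalar g}].
  have -> : nonscalar_size C = size Y.
    by rewrite size_map -cardE card_sig -cardsE.
  apply: leq_card_span => t.
  rewrite (_ : delta_mx 0 t = \sum_h e h (letter t) *:
     \row_t' wcoef (Q h) (letter t' :: nseq (d - 2) ord0)).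
    apply: memv_suml => h _; apply: memvZ; apply: memv_span.
    by apply: map_f; rewrite mem_enum.
  apply/rowP => t'; rewrite summxE !mxE eqxx /=.
  under eq_bigr do rewrite !mxE.
  rewrite -Ef; have := @wcoef_hard_letters t t' 0 (d - 2) [::].
  rewrite /= => ->; last by lia.
  by rewrite base_val_nseq0 eqxx andbT eq_sym.
have <- : #|{: T}| = (m.+1 * (d.-1 - l))%N by rewrite card_prod !card_ord.
apply: leq_trans (leq_card_span _) sX => t.
case Et: (enum_val t) => [i j].
have lt_j := ltn_ord j.
rewrite (_ : delta_mx 0 t = \sum_h e h (letter i) *:
     window ord0 y j (d - 2 - l - j) (Q h)).
  by apply: memv_suml => h _; apply: memvZ; apply: XQ.
apply/rowP => t'; rewrite summxE !mxE eqxx /=.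
under eq_bigr do rewrite !mxE.
rewrite -Ef /y; case Et': (enum_val t') => [i' j'] /=.
rewrite wcoef_hard_letters; last by rewrite size_digits; lia.
rewrite base_val_digits; last by apply: leq_trans le_nl; apply: ltn_ord.
rewrite -(inj_eq enum_val_inj) Et Et' xpair_eqE /=.
by rewrite [i' == i]eq_sym.
Qed.

(** With s the non-scalar size, the two bounds add up to [m.+1 * d <= 2 * l * s + l.+1 * s <= 4 * l
    * s], and [n <= 2 * m.+1]. *)
Lemma size_lower_bound l : (0 < l)%N -> (d.-1 - l <= n ^ l)%N ->
  (n * d <= 8 * (nonscalar_size C * l))%N.
Proof.
move=> l_gt0 /(lower_bounds l_gt0)[].
move: (nonscalar_size C) => s le_s le_sl.
have : (m.+1 * d <= m.+1 * (d.-1 - l) + m.+1 * l.+1)%N.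
  by rewrite -mulnDr leq_mul2l; lia.
by nia.
Qed.

End LowerBound.

(** * A random access machine program for the coefficients *)

Section RamPrograms.
Local Open Scope nat_scope.
Implicit Types (P Q : ram_prog) (s : ram_state).

Fixpoint loop_free P : bool :=
  match P with
  | RSeq P Q | RIf _ P Q => loop_free P && loop_free Q
  | RWhile _ _ => false
  | _ => true
  end.

(** Step count and final state of a [loop_free] program; the value at [RWhile] is a dummy. *)
Fixpoint run P s : nat * ram_state :=
  match P with
  | RSkip | RWhile _ _ => (1, s)
  | RConst x c => (1, set_reg s x c)
  | RAdd x y z => (1, set_reg s x (ram_reg s y + ram_reg s z))
  | RSub x y z => (1, set_reg s x (ram_reg s y - ram_reg s z))
  | RLoad x y => (1, set_reg s x (ram_mem s (ram_reg s y)))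
  | RStore x y => (1, set_mem s (ram_reg s x) (ram_reg s y))
  | RSeq P Q => let r := run P s in
                ((r.1 + (run Q r.2).1), (run Q r.2).2)
  | RIf x P Q => let r := if ram_reg s x == 0 then run Q s else run P s in
                 (r.1.+1, r.2)
  end.

Lemma run_exec P s : loop_free P -> ram_exec P s (run P s).1 (run P s).2.
Proof.
elim: P s => [|x c|x y z|x y z|x y|x y|P IHP Q IHQ|x P IHP Q IHQ|] s //=;
  try by move=> _; constructor.
- by case/andP=> lP lQ; apply: exec_seq; [apply: IHP | apply: IHQ].
- case/andP=> lP lQ; case: eqP => [e|/eqP ne].
    by apply: exec_if_false => //; apply: IHQ.
  by apply: exec_if_true => //; apply: IHP.
Qed.

(** Each round costs at most [T] steps and one for the test; the last unit pays for the failing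
    test. *)
Lemma exec_count_down x P T (I : nat -> ram_state -> Prop) :
  (forall m s, I m s -> ram_reg s x = m) ->
  (forall m s, I m.+1 s ->
     exists t s', [/\ ram_exec P s t s', t <= T & I m s']) ->
  forall m s, I m s -> exists t s',
    [/\ ram_exec (RWhile x P) s t s', t <= m * T.+1 + 1 & I 0 s'].
Proof.
move=> Ix IP; elim=> [|m IHm] s Is.
  by exists 1, s; split=> //; apply: exec_while_false; apply: Ix Is.
have [t1 [s1 [ex1 le1 I1]]] := IP m s Is.
have [t2 [s2 [ex2 le2 I2]]] := IHm s1 I1.
exists (t1 + t2).+1, s2; split=> //; last by rewrite mulSn; lia.
by apply: exec_while_true ex1 ex2; rewrite (Ix _ _ Is).
Qed.

Definition seq_prog (Ps : seq ram_prog) : ram_prog := foldr RSeq RSkip Ps.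

(* Registers: 0 = base [n], 3 = position, 4 = current letter, 5 = value of the
   letters read, 6 = answer so far, 7 = first letter, 8 = constant one,
   13 = constant zero, the others are scratch. *)
Definition test_letter : ram_prog := seq_prog
  [:: RLoad 4 3;
      RIf 4 (seq_prog
        [:: RSub 11 4 7; RSub 12 7 4; RAdd 11 11 12; RSub 14 3 8;
            RSub 12 5 14; RAdd 11 11 12; RSub 12 14 5; RAdd 11 11 12;
            RSub 6 8 11]) RSkip;
      RAdd 9 4 13; RAdd 10 0 13].

(** Multiplication by [n] as [n] additions: one step of Horner's rule on the value in register 5. *)
Definition horner_loop : ram_prog := RWhile 10 (RSeq (RAdd 9 9 5) (RSub 10 10 8)).

Definition next_letter : ram_prog := RSeq (RAdd 5 9 13) (RSub 3 3 8).

Definition scan_letter : ram_prog :=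
  RSeq test_letter (RSeq horner_loop next_letter).

Definition hard_prog : ram_prog :=
  RSeq (seq_prog [:: RConst 8 1; RSub 11 1 2; RSub 12 2 1; RAdd 11 11 12])
    (RIf 11 (RConst 0 0)
      (RSeq (RSeq (RLoad 7 13) (RSub 3 1 8))
        (RSeq (RWhile 3 scan_letter) (RAdd 0 6 13)))).

Variables (n : nat) (w : seq nat).

Definition scan_frame s : Prop :=
  [/\ ram_reg s 0 = n, ram_reg s 7 = head 0 w, ram_reg s 8 = 1,
      ram_reg s 13 = 0 & ram_mem s = nth 0 w].

(** The word is scanned from right to left. Register 6 holds the answer under the assumption that
    positions 1 to [c] all carry x_0. *)
Definition scan_inv c s : Prop := scan_frame s /\
  [/\ ram_reg s 3 = c, ram_reg s 5 = base_val n (drop c.+1 w)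
    & ram_reg s 6 = coded n (head 0 w) c (drop c.+1 w)].

Definition horner_inv a v c r k s : Prop := scan_frame s /\
  [/\ ram_reg s 10 = k, ram_reg s 3 = c, ram_reg s 5 = v, ram_reg s 6 = r
    & ram_reg s 9 + k * v = v * n + a].

Lemma horner_loopP a v c r s : horner_inv a v c r n s -> exists t s',
  [/\ ram_exec horner_loop s t s', t <= n * 3 + 1 & horner_inv a v c r 0 s'].
Proof.
apply: exec_count_down => [k {}s [_ []] //|k {}s].
case=> -[E0 E7 E8 E13 Em] [E10 E3 E5 E6 E9].
set P := RSeq _ _; exists (run P s).1, (run P s).2.
split=> //; first exact: run_exec.
split; first by split.
by split=> //=; rewrite ?E10 ?E8 ?E5 ?subn1 //; rewrite mulSn in E9; lia.
Qed.

(** For a nonzero letter, register 11 sums two absolute differences: letter against first letter,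
    and value against position minus one. It vanishes exactly when both agree, so subtracting it
    from 1 with truncation gives the truth value. *)
Lemma test_letterP c s : c.+1 < size w -> scan_inv c.+1 s ->
  (run test_letter s).1 <= 16 /\
  horner_inv (nth 0 w c.+1) (base_val n (drop c.+2 w)) c.+1
    (coded n (head 0 w) c (drop c.+1 w)) n (run test_letter s).2.
Proof.
move=> lt_c [[E0 E7 E8 E13 Em] [E3 E5 E6]].
rewrite (drop_nth 0 lt_c) /= Em E3.
case: (eqVneq (nth 0 w c.+1) 0) => [Ea|Na] /=.
  split=> //; split; first by split.
  by split=> //=; rewrite ?E0 ?E13 ?Em ?E3 ?addn0 // ?Ea; lia.
split=> //; split; first by split.
split=> //=; rewrite ?E0 ?E13 ?Em ?E3 ?addn0 //; last by lia.
by rewrite E5 E7 E8; lia.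
Qed.

Lemma scan_letterP c s : c.+1 < size w -> scan_inv c.+1 s -> exists t s',
  [/\ ram_exec scan_letter s t s', t <= n * 3 + 20 & scan_inv c s'].
Proof.
move=> lt_c /(test_letterP lt_c)[le1 /horner_loopP[t2 [s2 [ex2 le2]]]].
case=> -[E0 E7 E8 E13 Em] [E10 E3 E5 E6 E9].
exists ((run test_letter s).1 + (t2 + (run next_letter s2).1)).
exists (run next_letter s2).2; split.
- apply: exec_seq; first exact: run_exec.
  by apply: exec_seq ex2 _; apply: run_exec.
- have -> : (run next_letter s2).1 = 2 by []; lia.
- split; first by split.
  rewrite (drop_nth 0 lt_c); split=> //=.
  + by rewrite E3 E8 subn1.
  + by rewrite E13 addn0 -[LHS]addn0.
  + by rewrite E6 (drop_nth 0 lt_c).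
Qed.

Lemma scan_lettersP c s : c < size w -> scan_inv c s -> exists t s',
  [/\ ram_exec (RWhile 3 scan_letter) s t s', t <= c * (n * 3 + 21) + 1
    & scan_inv 0 s'].
Proof.
move=> lt_c inv_s.
have [||t [s' [ex le_t [_ inv0]]]] := @exec_count_down 3 scan_letter (n * 3 + 20)
    (fun c s => c < size w /\ scan_inv c s) _ _ c s (conj lt_c inv_s).
- by move=> {inv_s lt_c}c {}s [_ [_ []]].
- move=> {inv_s lt_c}c {}s [lt_c /(scan_letterP lt_c)[t [s' [ex le_t inv_s']]]].
  by exists t, s'; split=> //; split=> //; apply: ltnW.
by exists t, s'; split=> //; rewrite -addnS in le_t.
Qed.

Lemma hard_progP d : 1 < d -> exists t s',
  [/\ ram_exec hard_prog (RamState (nth 0 [:: n; d; size w]) (nth 0 w)) t s',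
      t <= d * (n * 3 + 21) + 20 & ram_reg s' 0 = hard_word n d w].
Proof.
move=> d_gt1; set s0 := RamState _ _.
set P1 := seq_prog [:: RConst 8 1; RSub 11 1 2; RSub 12 2 1; RAdd 11 11 12].
set s1 := (run P1 s0).2.
have ex1 : ram_exec P1 s0 5 s1 by apply: (run_exec (P := P1)).
have E11 : ram_reg s1 11 = (d - size w) + (size w - d) by [].
(* Register 11 is zero exactly when the word has length [d]; any other word is answered with 0 at
   once. *)
have [szw|szw] := eqVneq (size w) d; last first.
  exists (5 + 2), (set_reg s1 0 0); split; last by rewrite /hard_word (negbTE szw).
    apply: exec_seq ex1 _; apply: exec_if_true; last exact: exec_const.
    by rewrite E11; lia.
  by lia.
set P2 := RSeq (RLoad 7 13) (RSub 3 1 8); set s2 := (run P2 s1).2.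
have ex2 : ram_exec P2 s1 2 s2 by apply: (run_exec (P := P2)).
have [||t [s3 [ex3 le3 [[E0 E7 E8 E13 Em] [E3 E5 E6]]]]] :=
    @scan_lettersP d.-1 s2.
- by rewrite szw; lia.
- split; first by split=> //=; rewrite nth0.
  by split=> //=; rewrite ?subn1 // prednK ?drop_oversize ?szw //; lia.
exists (5 + (2 + (t + 1)).+1), (set_reg s3 0 (ram_reg s3 6 + ram_reg s3 13)).
split.
- apply: exec_seq ex1 _; apply: exec_if_false; first by rewrite E11 szw subnn.
  by apply: exec_seq ex2 _; apply: exec_seq ex3 _; apply: exec_add.
- by apply: leq_trans (_ : 10 + (d.-1 * (n * 3 + 21) + 1) <= _); nia.
- rewrite /= E6 E13 addn0 /hard_word szw eqxx.
  by case: w szw => [|i w'] szw //=; rewrite drop0.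
Qed.

End RamPrograms.

Lemma explicit_hard_poly (F : fieldType) : explicit (hard_poly F).
Proof.
exists hard_prog, 4%N => n d n_gt1 d_gt1 w.
have [t [s [ex le_t Es]]] := hard_progP n (map val w) d_gt1.
exists t, s; split; last by rewrite Es -wcoef_hard_poly /wcoef fmK.
  by rewrite /ram_input -(size_map val w).
apply: leq_trans le_t _; apply: leq_trans (_ : (n + d) ^ 4 <= _)%N; last first.
  by rewrite leq_exp2r // leq_addr.
(* Here [d * (n * 3 + 21) + 20 <= (n + d) ^ 4], as [n] and [d] are at least 2. *)
by rewrite (expnM _ 2 2); nia.
Qed.

(** * Choice of the window length and the asymptotic bounds *)

Theorem theorem3p2 :
  forall R : realType, exists c : R, 0 < c /\
  forall F : fieldType,
  exists f : forall n d : nat, ncpoly F n,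
    explicit f /\
    forall n d : nat, (1 < n)%N -> (1 < d)%N ->
      homogeneous_of_degree d (f n d) /\
      forall C : circuit F n, homogeneous_circuit C -> computes C (f n d) ->
        ((d <= n)%N -> c * (n%:R * d%:R) <= (nonscalar_size C)%:R) /\
        ((n <= d)%N ->
           c * (n%:R * d%:R * (ln n%:R / ln d%:R)) <= (nonscalar_size C)%:R).
Proof.
(* 16 is twice the 8 of [size_lower_bound]: for [n <= d] the integer [l] chosen below is at most
   twice ln d / ln n. *)
move=> R; exists 16%:R^-1; split; first by rewrite invr_gt0 ltr0n.
move=> F; exists (hard_poly F); split; first exact: explicit_hard_poly.
move=> n d n_gt1 d_gt1; split; first exact: hard_poly_homogeneous.
case: n n_gt1 => [|[|m]] // n_gt1 C homC compC.
have bound l : (0 < l)%N -> (d.-1 - l <= m.+2 ^ l)%N ->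
    m.+2%:R * d%:R <= 8%:R * ((nonscalar_size C)%:R * l%:R) :> R.
  move=> l_gt0 le_l; rewrite -!natrM ler_nat.
  exact: (size_lower_bound d_gt1 homC compC l_gt0 le_l).
split=> [le_dn|le_nd].
  (* One digit suffices, as [d - 2 <= n]. *)
  have := bound 1%N isT; rewrite expn1 mulr1 => /(_ ltac:(lia)).
  have s_ge0 : 0 <= (nonscalar_size C)%:R :> R by apply: ler0n.
  by rewrite ler_pdivrMl ?ltr0n //; lra.
(* Since [d < n ^ k.+1], windows with [k.+1] digits suffice. *)
pose k := trunc_log m.+2 d.
have /bound : (0 < k.+1)%N by [].
have lt_d : (d < m.+2 ^ k.+1)%N by apply: trunc_log_ltn.
move=> /(_ ltac:(lia)).
have le_kd : (m.+2 ^ k <= d)%N by apply: trunc_logP => //; apply: ltnW.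
have lnd_gt0 : 0 < ln d%:R :> R by rewrite ln_gt0 // ltr1n.
have ln_le : ln m.+2%:R <= ln d%:R :> R.
  by rewrite ler_ln ?posrE ?ltr0n ?ler_nat //; lia.
have lnk_le : k%:R * ln m.+2%:R <= ln d%:R :> R.
  rewrite mulr_natl -lnXn ?ltr0n // -natrX ler_ln ?posrE ?ltr0n ?ler_nat //.
    by rewrite expn_gt0.
  by lia.
move: (m.+2%:R * d%:R) => A le_A.
have lnn_ge0 : 0 <= ln m.+2%:R :> R by rewrite ln_ge0 // ler1n.
have s_ge0 : 0 <= (nonscalar_size C)%:R :> R by apply: ler0n.
rewrite ler_pdivrMl ?ltr0n // mulrA ler_pdivrMr //.
have := ler_wpM2r lnn_ge0 le_A.
(* Both [k * ln n] and [ln n] are at most [ln d]. *)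
have : (nonscalar_size C)%:R * (k.+1%:R * ln m.+2%:R) <=
       (nonscalar_size C)%:R * (2 * ln d%:R) :> R.
  by apply: ler_wpM2l => //; rewrite -natr1 mulrDl mul1r; lra.
lra.
Qed.
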